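(* Let $f\colon X\rightarrow Y$ be a continuous surjection between compact Hausdorff spaces. Then $f$ is open if and only if $2^f\colon 2^X\rightarrow 2^Y$ is open.
   Context: For a compact Hausdorff space $X$, the hyperspace $2^X$ is the collection of all non-empty closed subsets of $X$ equipped with the Vietoris topology, a base of which is formed by the sets $\langle U_1,\dotsc,U_n\rangle:=\{K\in 2^X\mid K\subseteq U_1\cup\dotsm\cup U_n,\ K\cap U_i\neq\emptyset,\ 1\le i\le n\}$ for all $n\ge 1$ and all non-empty open sets $U_1,\dotsc,U_n$ in $X$. A continuous surjection $f\colon X\to Y$ of compact Hausdorff spaces induces the continuous surjection $2^f\colon 2^X\to 2^Y$, $K\mapsto f[K]$. A map is open if the image of every open set is open. *)

(* Defs.v *)
From HB Require Import structures.
From mathcomp Require Import all_boot all_classical all_analysis.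

Set Implicit Arguments.
Unset Strict Implicit.
Unset Printing Implicit Defensive.

Local Open Scope classical_set_scope.

Record hyperspace (X : topologicalType) := Hyperspace {
  hset :> set X;
  hset_closed : closed hset;
  hset_nonempty : hset !=set0
}.

Arguments hset_closed {X} K : rename.
Arguments hset_nonempty {X} K : rename.

Lemma hyperspace_eq (X : topologicalType) (K L : hyperspace X) :
  hset K = hset L -> K = L.
Proof.
case: K L => [K cK nK] [L cL nL] /= KL; subst L.
by congr Hyperspace; exact: Prop_irrelevance.
Qed.

HB.instance Definition _ (X : topologicalType) := gen_eqMixin (hyperspace X).
HB.instance Definition _ (X : topologicalType) :=
  gen_choiceMixin (hyperspace X).

(* The basic set <U_1, ..., U_n>, for Us = [:: U_1; ...; U_n]. *)
Definition vietoris_basic (X : topologicalType) (Us : seq (set X)) :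
    set (hyperspace X) :=
  [set K : hyperspace X | hset K `<=` \bigcup_(U in [set` Us]) U /\
           forall U, U \in Us -> hset K `&` U !=set0].

Definition vietoris_index (X : topologicalType) : set (seq (set X)) :=
  [set Us | (0 < size Us)%N /\ forall U, U \in Us -> open U /\ U !=set0].

Lemma vietoris_cover (X : topologicalType) :
  \bigcup_(Us in vietoris_index (X := X)) vietoris_basic Us = setT.
Proof.
apply/seteqP; split => // K _; have [x Kx] := hset_nonempty K.
exists [:: setT]; split => //.
- by move=> U; rewrite inE => /eqP ->; split; [exact: openT|exists x].
- by move=> y _; exists setT; rewrite //= inE.
- by move=> U; rewrite inE => /eqP ->; exists x.
Qed.

Lemma vietoris_join (X : topologicalType) (Us Vs : seq (set X))
    (K : hyperspace X) :
  vietoris_index Us -> vietoris_index Vs ->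
  vietoris_basic Us K -> vietoris_basic Vs K ->
  exists Ws, [/\ vietoris_index Ws, vietoris_basic Ws K &
    vietoris_basic Ws `<=` vietoris_basic Us `&` vietoris_basic Vs].
Proof.
move=> [sU oU] [sV oV] [KU hU] [KV hV].
pose u := \bigcup_(U in [set` Us]) U; pose v := \bigcup_(V in [set` Vs]) V.
pose Ws := [seq U `&` v | U <- Us] ++ [seq V `&` u | V <- Vs].
have ou : open u by apply: bigcup_open => U /= /oU [].
have ov : open v by apply: bigcup_open => V /= /oV [].
have WU U : U \in Us -> U `&` v \in Ws.
  by move=> US; rewrite mem_cat (map_f (fun U => U `&` v)).
have WV V : V \in Vs -> V `&` u \in Ws.
  by move=> VS; rewrite mem_cat (map_f (fun V => V `&` u) VS) orbT.
have Wv W : W \in Ws -> W `<=` u `&` v.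
  rewrite mem_cat => /orP[] /mapP[U US ->] x [Ux ?]; split=> //; by exists U.
have hW W : W \in Ws -> hset K `&` W !=set0.
  rewrite mem_cat => /orP[] /mapP[U US ->].
    by have [x [Kx Ux]] := hU _ US; exists x; split => //; split => //; exact: KV.
  by have [x [Kx Ux]] := hV _ US; exists x; split => //; split => //; exact: KU.
exists Ws; split.
- split; first by rewrite size_cat size_map ltn_addr.
  move=> W WW; split; last by have [x [_ Wx]] := hW _ WW; exists x.
  move: WW; rewrite mem_cat => /orP[] /mapP[U US ->].
    by apply: openI => //; have [] := oU _ US.
  by apply: openI => //; have [] := oV _ US.
- split=> // x Kx; have [U US Ux] := KU _ Kx.
  by exists (U `&` v); [exact: WU|split => //; exact: KV].
- move=> L [LW hL]; split; split.
  + by move=> x /LW [W /= /Wv Wuv /Wuv []].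
  + move=> U US; have [x [Lx [Ux _]]] := hL _ (WU _ US).
    by exists x.
  + by move=> x /LW [W /= /Wv Wuv /Wuv []].
  + move=> V VS; have [x [Lx [Vx _]]] := hL _ (WV _ VS).
    by exists x.
Qed.

HB.instance Definition _ (T : choiceType) := isPointed.Build (seq T) [::].

HB.instance Definition _ (X : topologicalType) :=
  isBaseTopological.Build (hyperspace X) (@vietoris_cover X)
    (fun Us Vs K => @vietoris_join X Us Vs K).

Lemma hmap_closed (X Y : topologicalType) (f : X -> Y)
    (cX : compact [set: X]) (hY : hausdorff_space Y) (cf : continuous f)
    (K : hyperspace X) : closed (f @` hset K).
Proof.
apply: compact_closed => //; apply: continuous_compact.
  exact: continuous_subspaceT.
exact: (subclosed_compact (hset_closed K) cX).
Qed.

Arguments hmap_closed {X Y f} cX hY cf K : rename.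

Lemma hmap_nonempty (X Y : topologicalType) (f : X -> Y) (K : hyperspace X) :
  f @` hset K !=set0.
Proof. by have [x Kx] := hset_nonempty K; exists (f x), x. Qed.

Arguments hmap_nonempty {X Y} f K : rename.

(* The induced map 2^f. *)
Definition hmap (X Y : topologicalType) (f : X -> Y)
    (cX : compact [set: X]) (hY : hausdorff_space Y) (cf : continuous f)
    (K : hyperspace X) : hyperspace Y :=
  Hyperspace (hmap_closed cX hY cf K) (hmap_nonempty f K).

Definition open_map (X Y : topologicalType) (f : X -> Y) : Prop :=
  forall A : set X, open A -> open (f @` A).

(* Main.v *)
Require Import Defs.
From mathcomp Require Import all_boot all_classical all_analysis.

Local Open Scope classical_set_scope.

Lemma open_vietoris_basic (X : topologicalType) (Us : seq (set X)) :
  vietoris_index Us -> open (vietoris_basic Us).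
Proof.
move=> DUs; exists [set Us]; first by move=> _ ->.
by rewrite bigcup_set1.
Qed.

Lemma nbhs_vietorisP (X : topologicalType) (K : hyperspace X)
    (A : set (hyperspace X)) :
  nbhs K A <-> exists Us, [/\ vietoris_index Us, vietoris_basic Us K &
                              vietoris_basic Us `<=` A].
Proof.
split=> [|[Us [DUs KUs UsA]]]; last first.
  rewrite nbhsE; exists (vietoris_basic Us) => //.
  by split=> //; exact: open_vietoris_basic.
rewrite nbhsE => -[_ [[D sD <-] [Us DUs KUs]] UA].
by exists Us; split; [exact: sD| |move=> L UsL; apply: UA; exists Us].
Qed.

(** The singleton of [x]; its underlying set is inferred from the closedness proof. *)
Definition hpoint (X : topologicalType) (hX : hausdorff_space X) (x : X) :
    hyperspace X :=
  Hyperspace (@accessible_closed_set1 X (hausdorff_accessible hX) x)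
             (ex_intro _ x erefl).

(** The preimage of <U_1, ..., U_n> is the finite intersection of the open U_i. *)
Lemma continuous_hpoint (X : topologicalType) (hX : hausdorff_space X) :
  continuous (hpoint X hX).
Proof.
move=> x A /nbhs_vietorisP[Us [[sUs oUs] [_ xUs] UsA]].
have : nbhs x (\bigcap_(U in [set` Us]) U).
  rewrite bigcap_seq big_seq; elim/big_ind: _ => [||U UUs].
  - exact: filterT.
  - by move=> *; exact: filterI.
  - apply: open_nbhs_nbhs; split; first by have [] := oUs _ UUs.
    by have [_ [-> ]] := xUs _ UUs.
apply: filterS => y yUs; apply: UsA; split=> [_ ->|U UUs].
  by case: Us sUs yUs {oUs xUs} => // U Us _ yUs; exists U => /=;
    [|apply: yUs => /=]; rewrite mem_head.
by exists y; split=> //; exact: yUs.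
Qed.

Section hmap_open.
Variables (X Y : topologicalType) (f : X -> Y).
Hypotheses (cX : compact [set: X]) (hX : hausdorff_space X).
Hypotheses (hY : hausdorff_space Y) (cf : continuous f).

(* Given <U_1, ..., U_n> containing K, normality yields an open W with K in W
   and cl W in the union of the U_i. A closed L in <f[U_1 & W], ..., f[U_n & W]>
   is then the image of the closed set f^-1[L] & cl W: the closure makes the
   lift closed, and it still lies in the union of the U_i. *)
Lemma hmap_open : open_map f -> open_map (hmap cX hY cf).
Proof.
move=> of_ A oA; rewrite openE => _ [K AK <-].
have /nbhs_vietorisP[Us [[sUs oUs] [KUs hUs] UsA]] : nbhs K A.
  exact: open_nbhs_nbhs.
have [C KC CUs] : filter_from (set_nbhs (hset K)) closure
    (\bigcup_(U in [set` Us]) U).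
  apply: compact_normal => //; first exact: hset_closed.
  move=> x /KUs Ux; apply: open_nbhs_nbhs; split=> //.
  by apply: bigcup_open => U /oUs[].
(* [C] is a neighbourhood of [hset K], so [W] still contains [hset K]; [closure C] plays the part of
   cl W. *)
pose W := interior C.
have WU U : U \in Us -> open (f @` (U `&` W)).
  by move=> /oUs[oU _]; apply/of_/openI => //; exact: open_interior.
apply/nbhs_vietorisP; exists [seq f @` (U `&` W) | U <- Us]; split.
- split; first by rewrite size_map.
  move=> _ /mapP[U UUs ->]; split; first exact: WU.
  by have [x [/KC Wx Ux]] := hUs _ UUs; exists (f x), x.
- split=> [_ [x Kx <-]|_ /mapP[U UUs ->]].
    have [U UUs Ux] := KUs _ Kx.
    exists (f @` (U `&` W)) => /=; first exact: map_f.
    by exists x => //; split => //; exact: KC.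
  have [x [Kx Ux]] := hUs _ UUs.
  by exists (f x); split; exists x => //; split => //; exact: KC.
move=> L [LUs hL].
have WclC : W `<=` closure C.
  by apply: subset_trans (@subset_closure _ C); exact: interior_subset.
have clM : closed (f @^-1` hset L `&` closure C).
  apply: closedI; last exact: closed_closure.
  apply: preimage_closed; [by move=> x _; exact: cf|exact: hset_closed].
(* The sets f[U & W] cover [hset L], so each of its points has a preimage in [W]; thus the lift is
   non-empty and maps onto [hset L]. *)
have lift y : hset L y -> exists2 x, (f @^-1` hset L `&` closure C) x & f x = y.
  move=> Ly; have [_ /mapP[U _ ->] [x [_ Wx] xy]] := LUs _ Ly.
  by exists x => //; split; [rewrite /= xy|exact: WclC].
have M0 : f @^-1` hset L `&` closure C !=set0.
  by have [y /lift[x Mx _]] := hset_nonempty L; exists x.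
exists (Hyperspace clM M0).
  apply: UsA; split=> [x [_ /CUs]//|U UUs].
  (* The lift meets [U] because [hset L] meets f[U & W]. *)
  have [y [Ly [x [Ux Wx] xy]]] := hL _ (map_f (fun U => f @` (U `&` W)) UUs).
  by exists x; split=> //; split; [rewrite /= xy|exact: WclC].
apply: hyperspace_eq; apply/seteqP; split=> [_ [x [Lx _] <-]//|y /lift].
by case=> x Mx <-; exists x.
Qed.

(** For [x] in [A], the singleton of [f x] is the image of that of [x], so it lies in the open image
    of <A>. Pulling this image back along [hpoint] gives a neighbourhood of [f x]. It lies in f[A]:
    if the singleton of [y] is f[K] and [K] meets [A] at [z], then [f z] is [y]. *)
Lemma open_of_hmap : open_map (hmap cX hY cf) -> open_map f.
Proof.
move=> oF A oA; rewrite openE => _ [x Ax <-].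
have oFA : open (hmap cX hY cf @` vietoris_basic [:: A]).
  apply/oF/open_vietoris_basic; split=> // U.
  by rewrite inE => /eqP ->; split=> //; exists x.
have : nbhs (f x) (hpoint Y hY @^-1` (hmap cX hY cf @` vietoris_basic [:: A])).
  apply: continuous_hpoint; apply: open_nbhs_nbhs; split=> //.
  exists (hpoint X hX x).
    split=> [_ ->|U]; first by exists A; rewrite //= mem_head.
    by rewrite inE => /eqP ->; exists x.
  by apply: hyperspace_eq; rewrite /= image_set1.
apply: filterS => y [K [_ /(_ A)]]; rewrite mem_head => /(_ isT)[z [Kz Az]] fK.
exists z => //.
have : hset (hmap cX hY cf K) (f z) by exists z.
by rewrite fK.
Qed.

End hmap_open.

Theorem theorem3 (X Y : topologicalType)
  (cX : compact [set: X]) (hX : hausdorff_space X)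
  (cY : compact [set: Y]) (hY : hausdorff_space Y)
  (f : X -> Y) (cf : continuous f) (sf : set_surj [set: X] [set: Y] f) :
  open_map f <-> open_map (hmap cX hY cf).
Proof. by split; [exact: hmap_open|exact: open_of_hmap]. Qed.
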